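(* Let $\Phi\in\mathcal{E}_0(I)$ be such that the function $\Psi(u):=-\Phi(|u|)$ is $\Phi$-convex on $J:=I-I=\{x-y: x,y\in I\}$. Let $f:I\to\mathbb{R}$ be a function which admits a $\Phi$-convex minorant (i.e., there is a $\Phi$-convex function $g:I\to\mathbb{R}$ with $g\leq f$). Then the function $\underline{C}_\Phi(f)$ is the largest $\Phi$-convex function which is smaller than or equal to $f$.
   Context: $I\subseteq\mathbb{R}$ is a nonempty open interval and $\ell(I)\in(0,\infty]$ is its length. $\mathcal{E}(I)$ is the set of all functions $\Phi:[0,\ell(I))\to[0,\infty)$ (called error functions), and $\mathcal{E}_0(I)$ is the set of those $\Phi\in\mathcal{E}(I)$ with $\Phi(0)=0$. A function $f:I\to\mathbb{R}$ is called $\Phi$-convex if for all $x,y\in I$ and $t\in[0,1]$, $$f(tx+(1-t)y)\leq tf(x)+(1-t)f(y)+t\Phi((1-t)|x-y|)+(1-t)\Phi(t|x-y|).$$ The $\Phi$-convexity of $\Psi$ on $J=(-\ell(I),\ell(I))$ means the same inequality (with $\Psi$ in place of $f$) for all $t\in[0,1]$ and all $x,y\in J$ with $|x-y|<\ell(I)$. For $f:I\to\mathbb{R}$, the function $\underline{C}_\Phi(f):I\to[-\infty,\infty)$ is defined by $$\underline{C}_\Phi(f)(u):=\inf\big\{t\big(f(x)+\Phi((1-t)|y-x|)\big)+(1-t)\big(f(y)+\Phi(t|y-x|)\big) : x,y\in I,\ t\in[0,1],\ u=tx+(1-t)y\big\}.$$ *)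

(* Defs.v *)
From HB Require Import structures.
From mathcomp Require Import all_boot all_order all_algebra.
From mathcomp Require Import all_classical all_reals all_analysis.

Set Implicit Arguments.
Unset Strict Implicit.
Unset Printing Implicit Defensive.

Import Order.TTheory GRing.Theory Num.Theory.
Import numFieldNormedType.Exports.

Local Open Scope classical_set_scope.
Local Open Scope ring_scope.

(* Functions on I, on J = I - I, or on [0, l(I)[ are represented by functions
   on the whole of R; every condition below only involves their values on the
   intended domain. *)

Definition open_interval (R : realType) (I : set R) : Prop :=
  [/\ I !=set0, open I & is_interval I].

(* The length of I, possibly +oo. *)
Definition ell (R : realType) (I : set R) : \bar R :=
  (ereal_sup (EFin @` I) - ereal_inf (EFin @` I))%E.

Definition error_function (R : realType) (I : set R) (Phi : R -> R) : Prop :=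
  forall u, 0 <= u -> (u%:E < ell I)%E -> 0 <= Phi u.

Definition error_function0 (R : realType) (I : set R) (Phi : R -> R) : Prop :=
  error_function I Phi /\ Phi 0 = 0.

Definition Phi_convex_ineq (R : realType) (Phi f : R -> R) (x y t : R) : Prop :=
  f (t * x + (1 - t) * y) <=
    t * f x + (1 - t) * f y
    + t * Phi ((1 - t) * `|x - y|) + (1 - t) * Phi (t * `|x - y|).

Definition Phi_convex (R : realType) (I : set R) (Phi f : R -> R) : Prop :=
  forall x y t, I x -> I y -> 0 <= t <= 1 -> Phi_convex_ineq Phi f x y t.

Definition diff_set (R : realType) (I : set R) : set R :=
  [set x - y | x in I & y in I].

(* On I - I only pairs at distance less than l(I) are considered, since Phi is
   only meaningful on [0, l(I)[. *)
Definition Phi_convex_diff (R : realType) (I : set R) (Phi Psi : R -> R) : Prop :=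
  forall x y t, diff_set I x -> diff_set I y -> (`|x - y|%:E < ell I)%E ->
    0 <= t <= 1 -> Phi_convex_ineq Phi Psi x y t.

Definition minorant (R : realType) (I : set R) (g f : R -> R) : Prop :=
  forall u, I u -> g u <= f u.

Definition lower_C (R : realType) (I : set R) (Phi f : R -> R) (u : R) : \bar R :=
  ereal_inf [set z | exists x y t : R,
    [/\ I x, I y, 0 <= t <= 1, u = t * x + (1 - t) * y &
        z = (t * (f x + Phi ((1 - t) * `|y - x|))
             + (1 - t) * (f y + Phi (t * `|y - x|)))%:E]].

(* F is extended real valued a priori; being Phi-convex includes being real
   valued on I. *)
Definition largest_Phi_convex_minorant (R : realType) (I : set R)
    (Phi f : R -> R) (F : R -> \bar R) : Prop :=
  exists g : R -> R,
    [/\ forall u, I u -> F u = (g u)%:E,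
        Phi_convex I Phi g,
        minorant I g f &
        forall h : R -> R, Phi_convex I Phi h -> minorant I h f ->
          minorant I h g].

(* Main.v *)
Require Import Defs.
From HB Require Import structures.
From mathcomp Require Import all_boot all_order all_algebra.
From mathcomp Require Import all_classical all_reals all_analysis.
From mathcomp Require Import ring lra.

Import Order.TTheory GRing.Theory Num.Theory.
Import numFieldNormedType.Exports.

Local Open Scope classical_set_scope.
Local Open Scope ring_scope.

(** Write [F_u x := f x + Phi |x - u|].  When [u = t x + (1 - t) y] the numbers
    [(1 - t) |y - x|] and [t |y - x|] are the distances from [u] to [x] and to
    [y], so [lower_C I Phi f u] is the infimum of the two-point averages of
    [F_u] with barycentre [u], that is, the value at [u] of the convex envelope
    of [F_u].  With this reading, a Phi-convex [h] lies below [f] only if it lies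
    below [lower_C I Phi f] ([Phi_convex_minorant_le_lower_C]); as the pair
    [x = y = u] gives [lower_C I Phi f <= f], what remains is that
    [lower_C I Phi f], which is real valued thanks to the assumed minorant, is
    itself Phi-convex.

    Let [u = s p + (1 - s) q].  Splitting [p] and [q] into two points each
    averages [F_u] over four points with barycentre [u].  Instead of reducing
    these to two points, one uses a line through [(u, lower_C I Phi f u)] that
    stays below [F_u] ([two_point_support]): it bounds averages over any number
    of points.  The error terms of [F_u] at the two points [x], [y] splitting
    [p] are centred at [u] rather than at [p], and the Phi-convexity of
    [- Phi |.|] is exactly what recentres them, at the price of [Phi |p - u|]
    ([recentre]).  Hence the line, lowered by [Phi |p - u|], is below
    [lower_C I Phi f] at [p] ([lower_C_support]); averaging this bound at [p]
    and at [q] removes the slope and gives the Phi-convexity inequality. *)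

Lemma interval_comb (R : realType) (I : set R) (x y t : R) :
  is_interval I -> I x -> I y -> 0 <= t <= 1 -> I (t * x + (1 - t) * y).
Proof.
move=> intI Ix Iy /andP[t0 t1]; have [xy|/ltW yx] := leP x y.
- by apply: (intI x y) => //; apply/andP; split; nra.
- by apply: (intI y x) => //; apply/andP; split; nra.
Qed.

Lemma open_neighbours (R : realType) (I : set R) (u : R) : open I -> I u ->
  exists2 e : R, 0 < e & I (u - e) /\ I (u + e).
Proof.
move=> oI Iu.
have /nbhs_ballP[e /= e0 ballI] : nbhs u I by exact: open_nbhs_nbhs.
have h0 : 0 < e / 2 by rewrite divr_gt0.
have he : e / 2 < e by lra.
exists (e / 2) => //; split; apply: ballI; rewrite /ball /=.
- by rewrite opprB addrC subrK gtr0_norm.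
- by rewrite opprD addNKr normrN gtr0_norm.
Qed.

(** Openness makes the inequality strict: [I] extends beyond [x] and [y]. *)
Lemma dist_lt_ell (R : realType) (I : set R) (x y : R) :
  open I -> I x -> I y -> (`|x - y|%:E < ell I)%E.
Proof.
move=> oI; wlog yx : x y / y <= x => [wl Ix Iy|Ix Iy].
  by have [|/ltW] := leP y x => xy; [|rewrite distrC]; apply: wl.
have [e e0 [_ Ixe]] := open_neighbours R I x oI Ix.
rewrite ger0_norm ?subr_ge0// /ell.
apply: (@lt_le_trans _ _ ((x + e)%:E - y%:E)%E).
  by rewrite -EFinB lte_fin; lra.
apply: leeB; first by apply: ereal_sup_ubound; exists (x + e).
by apply: ereal_inf_lbound; exists y.
Qed.

Lemma dist_comb_l (R : realType) (x y t : R) : t <= 1 ->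
  (1 - t) * `|y - x| = `|x - (t * x + (1 - t) * y)|.
Proof.
move=> t1; rewrite -[X in X * _]ger0_norm ?subr_ge0// -normrM distrC.
by congr `| _ |; ring.
Qed.

Lemma dist_comb_r (R : realType) (x y t : R) : 0 <= t ->
  t * `|y - x| = `|y - (t * x + (1 - t) * y)|.
Proof.
by move=> t0; rewrite -[X in X * _]ger0_norm// -normrM; congr `| _ |; ring.
Qed.

(** A one-dimensional Hahn-Banach argument: for [x < u < y] the slope from [x]
    up to the point [(u, m)] is at most the slope from there to [y], so the
    supremum of the left slopes separates the two families. *)
Lemma two_point_support (R : realType) (I : set R) (F : R -> R) (u m : R) :
  open I -> I u ->
  (forall x y t, I x -> I y -> 0 <= t <= 1 -> u = t * x + (1 - t) * y ->
     m <= t * F x + (1 - t) * F y) ->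
  exists a : R, forall x, I x -> m + a * (x - u) <= F x.
Proof.
move=> oI Iu Hm; have [e e0 [Ime Ipe]] := open_neighbours R I u oI Iu.
have slopes x y : I x -> I y -> x < u -> u < y ->
    (m - F x) / (u - x) <= (F y - m) / (y - u).
  move=> Ix Iy xu uy.
  have yx0 : 0 < y - x by lra.
  have yxN0 : y - x != 0 by rewrite gt_eqF.
  have t01 : 0 <= (y - u) / (y - x) <= 1.
    by rewrite divr_ge0 ?ler_pdivrMr//=; lra.
  have /(Hm x y _ Ix Iy t01) : u = (y - u) / (y - x) * x
      + (1 - (y - u) / (y - x)) * y by field.
  have -> : (y - u) / (y - x) * F x + (1 - (y - u) / (y - x)) * F y =
      ((y - u) * F x + (u - x) * F y) / (y - x) by field.
  rewrite ler_pdivlMr// => le_m.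
  rewrite ler_pdivrMr ?subr_gt0// mulrAC ler_pdivlMr ?subr_gt0//; lra.
set A := [set (m - F x) / (u - x) | x in [set x | I x /\ x < u]].
have A0 : A !=set0.
  by exists ((m - F (u - e)) / (u - (u - e))); exists (u - e) => //; split=> //; lra.
have ubA y : I y -> u < y -> ubound A ((F y - m) / (y - u)).
  by move=> Iy uy _ [x [Ix xu] <-]; exact: slopes.
have supA : has_sup A.
  by split=> //; exists ((F (u + e) - m) / (u + e - u)); apply: ubA => //; lra.
exists (sup A) => x Ix; have [xu|ux|->] := ltgtP x u.
- have : (m - F x) / (u - x) <= sup A.
    by apply: ub_le_sup; [case: supA|exists x].
  by rewrite ler_pdivrMr ?subr_gt0//; lra.
- have : sup A <= (F x - m) / (x - u) by apply: ge_sup => //; exact: ubA.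
  by rewrite ler_pdivlMr ?subr_gt0//; lra.
- suff : m <= 1 * F u + (1 - 1) * F u by lra.
  by apply: Hm => //; [rewrite ler01 lexx|ring].
Qed.

Lemma lower_C_le (R : realType) (I : set R) (Phi f : R -> R) (u x y t : R) :
  I x -> I y -> 0 <= t <= 1 -> u = t * x + (1 - t) * y ->
  (lower_C I Phi f u <=
   (t * (f x + Phi `|x - u|) + (1 - t) * (f y + Phi `|y - u|))%:E)%E.
Proof.
move=> Ix Iy t01 uE; apply: ereal_inf_lbound.
exists x, y, t; split=> //; case/andP: t01 => t0 t1.
by rewrite dist_comb_l// dist_comb_r// -uE.
Qed.

Lemma lower_C_ge (R : realType) (I : set R) (Phi f : R -> R) (u m : R) :
  (forall x y t, I x -> I y -> 0 <= t <= 1 -> u = t * x + (1 - t) * y ->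
     m <= t * (f x + Phi `|x - u|) + (1 - t) * (f y + Phi `|y - u|)) ->
  (m%:E <= lower_C I Phi f u)%E.
Proof.
move=> Hm; apply: le_ereal_inf_tmp => _ [x [y [t [Ix Iy t01 uE ->]]]].
have := Hm x y t Ix Iy t01 uE; case/andP: t01 => t0 t1.
by rewrite lee_fin dist_comb_l// dist_comb_r// -uE.
Qed.

Lemma lower_C_le_self (R : realType) (I : set R) (Phi f : R -> R) (u : R) :
  Phi 0 = 0 -> I u -> (lower_C I Phi f u <= (f u)%:E)%E.
Proof.
move=> Phi0 Iu.
have uE : u = 1 * u + (1 - 1) * u by ring.
have t01 : 0 <= (1 : R) <= 1 by rewrite ler01 lexx.
have := lower_C_le R I Phi f u u u 1 Iu Iu t01 uE.
by rewrite !subrr normr0 Phi0 mul0r mul1r !addr0.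
Qed.

Lemma Phi_convex_ineqE (R : realType) (Phi f : R -> R) (x y t : R) :
  0 <= t <= 1 ->
  Phi_convex_ineq Phi f x y t =
  is_true (f (t * x + (1 - t) * y) <=
     t * (f x + Phi `|x - (t * x + (1 - t) * y)|)
     + (1 - t) * (f y + Phi `|y - (t * x + (1 - t) * y)|)).
Proof.
move=> /andP[t0 t1]; rewrite /Phi_convex_ineq (distrC x y).
rewrite dist_comb_l// dist_comb_r//.
by congr (is_true (_ <= _)); ring.
Qed.

Lemma Phi_convex_minorant_le_lower_C (R : realType) (I : set R)
    (Phi f h : R -> R) (u : R) :
  Phi_convex I Phi h -> minorant I h f -> ((h u)%:E <= lower_C I Phi f u)%E.
Proof.
move=> hconv hf; apply: lower_C_ge => x y t Ix Iy t01 uE.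
have := hconv x y t Ix Iy t01; rewrite Phi_convex_ineqE// -uE => /le_trans.
have := hf x Ix; have := hf y Iy; case/andP: t01 => t0 t1 fy fx; apply.
by apply: lerD; apply: ler_wpM2l; rewrite ?subr_ge0// lerD2r.
Qed.

(** The Phi-convexity inequality of [- Phi |.|] between [x - u] and [y - u],
    whose barycentre is [p - u]. *)
Lemma recentre (R : realType) (I : set R) (Phi : R -> R) (x y t u p : R) :
  open I -> Phi_convex_diff I Phi (fun v => - Phi `|v|) ->
  I x -> I y -> I u -> 0 <= t <= 1 -> p = t * x + (1 - t) * y ->
  t * Phi `|x - u| + (1 - t) * Phi `|y - u| <=
  t * Phi `|x - p| + (1 - t) * Phi `|y - p| + Phi `|p - u|.
Proof.
move=> oI hPsi Ix Iy Iu t01 pE.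
have E : t * (x - u) + (1 - t) * (y - u) = p - u by rewrite pE; ring.
have := hPsi (x - u) (y - u) t.
rewrite Phi_convex_ineqE// E !opprB !subrKA => /(_ _ _ _ t01) H.
suff : - Phi `|p - u| <= t * (- Phi `|x - u| + Phi `|x - p|)
    + (1 - t) * (- Phi `|y - u| + Phi `|y - p|) by lra.
by apply: H; [exists x => //; exists u|exists y => //; exists u
             |exact: dist_lt_ell].
Qed.

(** The line supporting [F_u] at [u] bounds the two-point averages of [F_u] with
    any barycentre [p]; by [recentre] these exceed the averages defining
    [lower_C I Phi f p] by at most [Phi |p - u|]. *)
Lemma lower_C_support (R : realType) (I : set R) (Phi f : R -> R) (u m : R) :
  open I -> Phi_convex_diff I Phi (fun v => - Phi `|v|) -> I u ->
  (m%:E <= lower_C I Phi f u)%E ->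
  exists a : R, forall p,
    ((m + a * (p - u) - Phi `|p - u|)%:E <= lower_C I Phi f p)%E.
Proof.
move=> oI hPsi Iu m_le.
have [|a Ha] := two_point_support R I (fun x => f x + Phi `|x - u|) u m oI Iu.
  move=> x y t Ix Iy t01 uE; rewrite -lee_fin.
  by apply: (le_trans m_le); exact: lower_C_le.
exists a => p; apply: lower_C_ge => x y t Ix Iy t01 pE.
have := recentre R I Phi x y t u p oI hPsi Ix Iy Iu t01 pE.
have -> : m + a * (p - u) =
    t * (m + a * (x - u)) + (1 - t) * (m + a * (y - u)) by rewrite pE; ring.
case/andP: t01 => t0 t1; have := ler_wpM2l t0 (Ha x Ix).
have t1' : 0 <= 1 - t by rewrite subr_ge0.
by have := ler_wpM2l t1' (Ha y Iy); lra.
Qed.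

Lemma lower_C_Phi_convex (R : realType) (I : set R) (Phi f g : R -> R) :
  open I -> is_interval I -> Phi_convex_diff I Phi (fun v => - Phi `|v|) ->
  (forall u, I u -> lower_C I Phi f u = (g u)%:E) -> Phi_convex I Phi g.
Proof.
move=> oI intI hPsi gE p q s Ip Iq s01; rewrite Phi_convex_ineqE//.
have Iu := interval_comb R I p q s intI Ip Iq s01.
set u := s * p + _ in Iu *.
have [|a Ha] := lower_C_support R I Phi f u (g u) oI hPsi Iu.
  by rewrite gE.
case/andP: s01 => s0 s1; have s1' : 0 <= 1 - s by rewrite subr_ge0.
have := Ha p; rewrite gE// lee_fin => /(ler_wpM2l s0).
have := Ha q; rewrite gE// lee_fin => /(ler_wpM2l s1').
have : s * (a * (p - u)) + (1 - s) * (a * (q - u)) = 0 by rewrite /u; ring.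
lra.
Qed.

Theorem theorem5p3 (R : realType) (I : set R) (Phi f : R -> R)
  (hI : open_interval I)
  (hPhi : error_function0 I Phi)
  (hPsi : Phi_convex_diff I Phi (fun u : R => - Phi `|u|))
  (hf : exists g : R -> R, Phi_convex I Phi g /\ minorant I g f) :
  largest_Phi_convex_minorant I Phi f (lower_C I Phi f).
Proof.
have [_ oI intI] := hI; have [_ Phi0] := hPhi.
have [g0 [g0conv g0f]] := hf.
have CE u : I u -> lower_C I Phi f u = (fine (lower_C I Phi f u))%:E.
  move=> Iu; rewrite fineK// fin_numElt; apply/andP; split.
  - apply: (@lt_le_trans _ _ (g0 u)%:E); first exact: ltNyr.
    exact: Phi_convex_minorant_le_lower_C.
  - apply: (@le_lt_trans _ _ (f u)%:E); last exact: ltry.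
    exact: lower_C_le_self.
exists (fun u => fine (lower_C I Phi f u)); split=> //.
- exact: (lower_C_Phi_convex R I Phi f).
- by move=> u Iu; rewrite -lee_fin -CE//; exact: lower_C_le_self.
- move=> h hconv hmin u Iu; rewrite -lee_fin -CE//.
  exact: Phi_convex_minorant_le_lower_C.
Qed.
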